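(* Let $c<\sqrt{2}$ be a constant. There exists $n_0=n_0(c)$ such that the following holds for every $n\ge n_0$. Let $G$ be a finite simple graph on $n$ vertices without isolated vertices, with maximum degree $\Delta$ and minimum degree $\delta$, such that $\Delta/\delta<c$. Let $0=\lambda_0\le\lambda_1\le\cdots\le\lambda_{n-1}$ be the eigenvalues of the normalized Laplacian of $G$. If $$|1-\lambda_i|\le \frac{(\log\log n)^{2}}{7500\,\log n\,(\log\log\log n)}\quad\text{for all } i\neq 0,$$ then $G$ is Hamiltonian.
   Context: For a finite simple graph $G$ with vertices $v_1,\dots,v_n$ and no isolated vertices, let $A$ be its adjacency matrix, $D$ the diagonal matrix of vertex degrees, and $L=D-A$. The normalized Laplacian of $G$ is $\mathcal{L}=D^{-1/2}LD^{-1/2}$; its eigenvalues are listed with multiplicity. $G$ is Hamiltonian if it contains a cycle passing through all vertices of $G$. $\log$ denotes the natural logarithm. *)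

(* Defs.v *)
From mathcomp Require Import all_boot all_order all_algebra.
From mathcomp Require Import reals.

Set Implicit Arguments.
Unset Strict Implicit.
Unset Printing Implicit Defensive.

Import Order.TTheory GRing.Theory Num.Theory.
Local Open Scope ring_scope.

(* A simple graph on n vertices is a symmetric irreflexive relation on 'I_n. *)
Definition simple_graph n (e : rel 'I_n) := symmetric e /\ irreflexive e.

Definition no_isolated_vertex n (e : rel 'I_n) := forall u, exists v, e u v.

Definition degree n (e : rel 'I_n) (u : 'I_n) : nat := #|[set v | e u v]|.

Definition max_degree n (e : rel 'I_n) : nat := (\max_(u < n) degree e u)%N.

(* The default value n exceeds every degree, so it never affects the minimum
   when n > 0. *)
Definition min_degree n (e : rel 'I_n) : nat :=
  \big[minn/n]_(u < n) degree e u.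

Section NormalizedLaplacian.
Variables (R : realType) (n : nat) (e : rel 'I_n).

Definition adjacency_mx : 'M[R]_n := \matrix_(u, v) (e u v)%:R.

Definition degree_mx : 'M[R]_n := diag_mx (\row_u (degree e u)%:R).

Definition degree_invsqrt_mx : 'M[R]_n :=
  diag_mx (\row_u (Num.sqrt (degree e u)%:R)^-1).

Definition laplacian_mx : 'M[R]_n := degree_mx - adjacency_mx.

Definition normalized_laplacian_mx : 'M[R]_n :=
  degree_invsqrt_mx *m laplacian_mx *m degree_invsqrt_mx.

End NormalizedLaplacian.

(* s lists the eigenvalues of M in nondecreasing order, each repeated according
   to its multiplicity as a root of the characteristic polynomial. *)
Definition ordered_spectrum (R : realType) n (M : 'M[R]_n) (s : n.-tuple R) :=
  sorted <=%R s /\ char_poly M = \prod_(x <- s) ('X - x%:P).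

Definition hamiltonian n (e : rel 'I_n) :=
  exists s : seq 'I_n, [/\ (3 <= size s)%N, ucycle e s & forall v, v \in s].

(* Main.v *)
Require Import Defs.
From mathcomp Require Import all_boot all_order all_algebra.
From mathcomp Require Import perm boolp reals sequences exp complex.
From mathcomp Require Import zify ring lra.

(** Proof idea. Let [P] be a longest path, cut into [Theta (log n)] consecutive
blocks, and let [th] bound all [|1 - lambda_i|] with [i <> 0]. By the spectral
gap, all but [O (th^2 n log n)] vertices see a fair share of almost every block,
and [th^2 log n] tends to [0]. This exceptional set is enlarged slightly to a
set [F] such that no vertex outside [F] has many neighbours lying next to [F]
on [P]. A Posa rotation multiplies the number of reachable end vertices by
about [th^-2], so [O (log n)] rotations at either end of [P] give a path [Q] on
the same vertices with both ends outside [F]. Only [O (log n)] edges of [P] have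
been broken, hence each half of [Q] contains a constant fraction of the blocks
and every vertex outside [F] has a constant fraction of its neighbours in each
half. Rotations inside the first half at one end and inside the second half at
the other end, with end vertices kept outside [F], do not interfere, and each
kind reaches linearly many end vertices. An edge between the two sets of
end vertices closes a cycle on the vertex set of [P], which must be Hamiltonian
because [P] is longest and the graph is connected. *)

Set Implicit Arguments.
Unset Strict Implicit.
Unset Printing Implicit Defensive.

(** * Consecutive vertices of a path *)

Section ConsecutivePairs.
Variable T : eqType.
Implicit Types (x y u v w : T) (s p q : seq T) (f : pred T).

Fixpoint pairs s : seq (T * T) :=
  if s is x :: s' then (if s' is y :: _ then (x, y) :: pairs s' else [::])
  else [::].

Lemma pairs_cat p x q : pairs (p ++ x :: q) = pairs (rcons p x) ++ pairs (x :: q).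
Proof. by elim: p => [|y [|z p] IH] //; congr (_ :: _); exact: IH. Qed.

Lemma pairs_rcons x p y :
  pairs (rcons (x :: p) y) = rcons (pairs (x :: p)) (last x p, y).
Proof. by elim: p x => [|z p IH] x //; congr (_ :: _); exact: IH. Qed.

Lemma pairs_rev s : pairs (rev s) = rev [seq (a.2, a.1) | a <- pairs s].
Proof.
elim: s => [|x [|y s] IH] //.
by rewrite [rev _]rev_cons (rev_cons y) -cats1 cat_rcons pairs_cat -rev_cons IH /= rev_cons cats1.
Qed.

Definition adjc s u w := ((u, w) \in pairs s) || ((w, u) \in pairs s).

Lemma adjcC s u w : adjc s u w = adjc s w u.
Proof. by rewrite /adjc orbC. Qed.

Lemma adjc_rev s u w : adjc (rev s) u w = adjc s u w.
Proof.
have E a b : ((a, b) \in pairs (rev s)) = ((b, a) \in pairs s).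
  rewrite pairs_rev mem_rev; apply/mapP/idP => [[[c d] H [-> ->]] //|H].
  by exists (b, a).
by rewrite /adjc !E orbC.
Qed.

Lemma adjc_cat p x q u w :
  adjc (p ++ x :: q) u w = adjc (rcons p x) u w || adjc (x :: q) u w.
Proof. by rewrite /adjc pairs_cat !mem_cat orbACA. Qed.

Lemma adjc_rcons x p y u w : adjc (rcons (x :: p) y) u w =
  adjc (x :: p) u w || ((u, w) == (last x p, y)) || ((w, u) == (last x p, y)).
Proof.
by rewrite /adjc pairs_rcons !mem_rcons !inE orbACA [LHS]orbC orbA.
Qed.

Lemma mem_pairs s u w : (u, w) \in pairs s -> (u \in s) && (w \in s).
Proof.
elim: s => [|x [|y s] IH] //; rewrite in_cons => /orP[/eqP[-> ->]|/IH/andP[a b]].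
  by rewrite !inE !eqxx ?orbT.
by rewrite a orbT in_cons b orbT.
Qed.

Lemma adjc_mem s u w : adjc s u w -> u \in s.
Proof. by case/orP => /mem_pairs/andP[]. Qed.

Lemma adjc_head w s u : w \notin s -> adjc (w :: s) u w -> u = head w s.
Proof.
case: s => [|y s] //= wN; rewrite /adjc /= !inE => /orP[]/orP[].
- by move=> /eqP[_ ywE]; rewrite ywE inE eqxx in wN.
- by move=> /(@mem_pairs (y :: s))/andP[_ H]; rewrite H in wN.
- by move=> /eqP[].
- by move=> /(@mem_pairs (y :: s))/andP[H _]; rewrite H in wN.
Qed.

Lemma adjc_sub p q u w : adjc p u w || adjc q u w -> adjc (p ++ q) u w.
Proof.
case: q => [|y q]; first by rewrite cats0 /adjc /= orbF.
rewrite adjc_cat; case: p => [|x p] //; rewrite adjc_rcons.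
by case/orP => -> //; rewrite orbT.
Qed.

(** Reversing the prefix keeps its inner edges and drops the edge from [last x p] to [v]; the only
    new edge joins [x] to [v]. *)
Lemma adjc_rotation x p v q u w : adjc (rev (x :: p) ++ v :: q) u w ->
  [|| adjc (x :: p ++ v :: q) u w, (u, w) == (x, v) | (w, u) == (x, v)].
Proof.
rewrite adjc_cat -rev_cons adjc_rev -cat_cons adjc_cat (adjc_rcons x p).
case/orP=> [|->]; last by rewrite !orbT.
rewrite -[v :: x :: p]/([:: v] ++ x :: p) adjc_cat (adjc_rcons v [::] x) /=.
by case/orP => [/orP[]/eqP[-> ->]|->]; rewrite ?eqxx ?orbT.
Qed.

Lemma adjc_pivot x p v q : adjc (x :: p ++ v :: q) v (last x p).
Proof. by rewrite -cat_cons adjc_cat adjc_rcons eqxx !orbT. Qed.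

(** For [f] the indicator of a vertex set, this measures how fragmented the set is along the path.
    It is applied to the halves of a rotated path. *)
Definition chg f s := count (fun a => f a.1 != f a.2) (pairs s).

Lemma chg_cat f p x q : chg f (p ++ x :: q) = chg f (rcons p x) + chg f (x :: q).
Proof. by rewrite /chg pairs_cat count_cat. Qed.

Lemma chg_rcons f x p y :
  chg f (rcons (x :: p) y) = chg f (x :: p) + (f (last x p) != f y).
Proof. by rewrite /chg pairs_rcons -cats1 count_cat /= addn0. Qed.

Lemma chg_rev f s : chg f (rev s) = chg f s.
Proof.
rewrite /chg pairs_rev count_rev count_map; apply: eq_count => a /=.
by rewrite eq_sym.
Qed.

Lemma chg_cat_ge f p q : chg f p + chg f q <= chg f (p ++ q).
Proof.
case: q => [|y q]; first by rewrite cats0 /chg /= addn0.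
by rewrite chg_cat leq_add2r; case: p => [|x p] //; rewrite chg_rcons leq_addr.
Qed.

Lemma chg_const f b s : (forall x, x \in s -> f x = b) -> chg f s = 0.
Proof.
move=> fb; apply/eqP; rewrite -leqn0 leqNgt -has_count.
apply/hasPn => -[u w] /mem_pairs/andP[/= us ws].
by rewrite !fb // eqxx.
Qed.

Lemma chg_eq0 f x s : chg f (x :: s) = 0 -> all (fun y => f y == f x) s.
Proof.
elim: s x => [|y s IH] x //=; rewrite /chg /= => /eqP.
rewrite addn_eq0 eqb0 negbK => /andP[/eqP fxy /eqP /IH H].
by rewrite fxy eqxx.
Qed.

Lemma chg_split f p q : (forall x, x \in p -> f x) ->
  (forall x, x \in q -> ~~ f x) -> chg f (p ++ q) <= 1.
Proof.
move=> fp fq; case: q fq => [|y q] fq.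
  by rewrite cats0 (@chg_const _ true) // => x /fp.
rewrite chg_cat (@chg_const _ false (y :: q)) ?addn0; last by move=> x /fq /negbTE.
case: p fp => [|x p] fp //; rewrite chg_rcons (@chg_const _ true (x :: p)).
  by rewrite add0n leq_b1.
by move=> z /fp.
Qed.

End ConsecutivePairs.

Section PathNeighbours.
Variable T : finType.
Implicit Types (P : seq T) (F S : {set T}).

Definition path_nbrs P F := [set u | [exists w in F, adjc P u w]].

Lemma path_nbrs1 P w : uniq P -> #|[set u | adjc P u w]| <= 2.
Proof.
move=> uP; case: (boolP (w \in P)) => wP; last first.
  rewrite (_ : [set u | _] = set0) ?cards0 //; apply/setP => u; rewrite !inE.
  by apply: contraNF wP; rewrite adjcC => /adjc_mem.
case/splitPr: wP uP => p q; rewrite cat_uniq /= => /and4P[up /norP[wp _] wq uq].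
apply: (@leq_trans #|[set last w p; head w q]|); last by rewrite cards2; case: (_ != _).
apply: subset_leq_card; apply/subsetP => u; rewrite !inE adjc_cat.
case/orP => [|/(adjc_head wq) ->]; last by rewrite eqxx orbT.
rewrite -adjc_rev rev_rcons => /adjc_head; rewrite mem_rev => /(_ wp) ->.
by case: (lastP p) => [|p' z]; rewrite ?rev_rcons ?last_rcons /= eqxx.
Qed.

Lemma card_path_nbrs P F : uniq P -> #|path_nbrs P F| <= 2 * #|F|.
Proof.
move=> uP; have -> : path_nbrs P F = \bigcup_(w in F) [set u | adjc P u w].
  apply/setP => u; rewrite inE; apply/exists_inP/bigcupP => -[w wF H]; exists w => //.
    by rewrite inE.
  by rewrite inE in H.
rewrite mulnC -sum_nat_const.
elim/big_rec2: _ => [|w k A _ IH]; first by rewrite cards0.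
apply: leq_trans (leq_card_setU _ _) _; apply: leq_add => //; exact: path_nbrs1.
Qed.

Lemma path_nbrsS P F S : F \subset S -> path_nbrs P F \subset path_nbrs P S.
Proof.
move=> FS; apply/subsetP => u; rewrite !inE => /exists_inP[w wF H].
by apply/exists_inP; exists w => //; apply: (subsetP FS).
Qed.

End PathNeighbours.

(** * Posa rotations *)

Section Rotations.
Variables (T : finType) (e : rel T).
Hypotheses (e_sym : symmetric e) (e_irr : irreflexive e).
Implicit Types (x y u v w : T) (P Q : seq T) (F S Z W : {set T}).

Lemma rev_sortedC s : sorted e (rev s) = sorted e s.
Proof. by rewrite rev_sorted; apply: eq_sorted => x y; rewrite e_sym. Qed.

Lemma sorted_rotation x p v q : sorted e (x :: p ++ v :: q) -> e x v ->
  sorted e (rev (x :: p) ++ v :: q).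
Proof.
rewrite -cat_cons sorted_cat_cons => /andP[Hp Hq] exv.
rewrite sorted_cat_cons Hq andbT -rev_cons rev_sortedC /= e_sym exv /=.
by move: Hp; rewrite rcons_cons /= rcons_path => /andP[].
Qed.

Section Reach.
Variables (F : {set T}) (P : seq T).

(* At most [i] rotations: the path turns around its pivot [v], its last vertex
   stays fixed and its new first vertex must avoid [F]. *)
Inductive reach : nat -> seq T -> Prop :=
| Reach0 : reach 0 P
| ReachS i Q : reach i Q -> reach i.+1 Q
| ReachRot i x p v q : reach i (x :: p ++ v :: q) -> e x v -> last x p \notin F ->
    reach i.+1 (rev (x :: p) ++ v :: q).

Lemma reach_perm i Q : reach i Q -> perm_eq Q P.
Proof.
elim=> // {}i x p v q _ IH _ _; apply: perm_trans IH.
by rewrite -cat_cons perm_cat2r perm_rev.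
Qed.

Lemma reach_mem i Q : reach i Q -> Q =i P.
Proof. by move/reach_perm/perm_mem. Qed.

Lemma reach_uniq i Q : reach i Q -> uniq P -> uniq Q.
Proof. by move/reach_perm/perm_uniq->. Qed.

Lemma reach_sorted i Q : sorted e P -> reach i Q -> sorted e Q.
Proof. by move=> sP; elim=> // {}i x p v q _ IH exv _; exact: sorted_rotation. Qed.

Lemma reach_last x0 i Q : reach i Q -> last x0 Q = last x0 P.
Proof. by elim=> // {}i x p v q _ <- _ _; rewrite /= !last_cat. Qed.

Lemma reach_head x0 i Q : head x0 P \notin F -> reach i Q -> head x0 Q \notin F.
Proof.
move=> hP; elim=> // {}i x p v q _ _ _; case/lastP: p => [|p z] //.
by rewrite last_rcons rev_cons rev_rcons.
Qed.

(** A rotation trades one edge for another, so it loses at most one change. Hence a half of a path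
    obtained by few rotations consists of few intervals of [P]. *)
Lemma reach_chg f i Q : reach i Q -> chg f P <= chg f Q + i.
Proof.
elim=> [|{}i {}Q _ IH|{}i x p v q _ IH _ _]; first by rewrite addn0.
  by apply: leq_trans IH _; rewrite leq_add2l.
apply: leq_trans IH _; rewrite addnS -addSn leq_add2r -cat_cons chg_cat chg_rcons.
rewrite chg_cat -rev_cons chg_rev [v :: _]lock /chg /= -lock.
by rewrite -/(chg f (x :: p)) -/(chg f _); case: (_ != _); case: (_ != _); lia.
Qed.

(** [Z] collects both ends of every edge added by a rotation. *)
Lemma reach_touched i Q : reach i Q -> exists2 Z : {set T}, #|Z| <= 2 * i &
  forall u w, adjc Q u w -> adjc P u w || (u \in Z).
Proof.
elim=> [|{}i {}Q _ [Z cZ H]|{}i x p v q _ [Z cZ H] _ _].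
- by exists set0 => [|u w ->]; rewrite ?cards0.
- by exists Z => //; lia.
exists (x |: (v |: Z)) => [|u w].
  by rewrite !cardsU1; case: (_ \notin _); case: (_ \notin _); lia.
rewrite !inE => /adjc_rotation/or3P[/H/orP[]->|/eqP[-> _]|/eqP[_ ->]].
all: by rewrite ?eqxx ?orbT.
Qed.

Definition heads i := [set x | `[< exists q, reach i (x :: q) >]].

Lemma headsP i x : reflect (exists q, reach i (x :: q)) (x \in heads i).
Proof. by rewrite inE; exact: asboolP. Qed.

Lemma heads_step i : heads i \subset heads i.+1.
Proof.
by apply/subsetP => x /headsP[q r]; apply/headsP; exists q; exact: ReachS.
Qed.

Definition near_heads i := heads i :|: path_nbrs P (heads i).

Lemma near_heads_step i : near_heads i \subset near_heads i.+1.
Proof. by apply: setUSS; [|apply: path_nbrsS]; exact: heads_step. Qed.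

Lemma card_near_heads i : uniq P -> #|near_heads i| <= 3 * #|heads i|.
Proof.
move=> uP; apply: leq_trans (leq_card_setU _ _) _.
by rewrite mulSn leq_add2l card_path_nbrs.
Qed.

(** The rotation makes [last x p] a head, so a pivot next to it on [P] becomes a path neighbour of a
    head. *)
Lemma pivot_near i x p v q : reach i (x :: p ++ v :: q) -> e x v ->
  last x p \notin F -> adjc P v (last x p) || (v \in near_heads i) ->
  v \in near_heads i.+1.
Proof.
move=> r exv yF /orP[vy|]; last by apply: (subsetP (near_heads_step i)).
apply/setUP; right; rewrite inE; apply/exists_inP; exists (last x p) => //.
apply/headsP; have := ReachRot r exv yF; case/lastP: p {r yF vy} => [|p z].
  by exists (v :: q).
by rewrite last_rcons rev_cons rev_rcons /= => r; eexists; exact: r.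
Qed.

(* A rotation adds the edge from the old first vertex to the pivot, and the
   vertex cut off from the pivot becomes the new first vertex. *)
Lemma reach_new_edge i Q : reach i Q ->
  forall u w, adjc Q u w -> adjc P u w || (u \in near_heads i).
Proof.
elim=> [u w -> //|{}i {}Q _ IH u w|{}i x p v q r IH exv yF u w].
  by case/IH/orP => [->|/(subsetP (near_heads_step i))->]; rewrite ?orbT.
case/adjc_rotation/or3P => [/IH/orP[->//|]|/eqP[-> _]|/eqP[_ ->]].
- by move/(subsetP (near_heads_step i))->; rewrite orbT.
- apply/orP; right; apply: (subsetP (near_heads_step i)).
  by apply/setUP; left; apply/headsP; exists (p ++ v :: q).
- by apply/orP; right; apply: (pivot_near r) => //; apply: IH; exact: adjc_pivot.
Qed.

(** Posa's argument. Let [y] precede [v] on the path with head [x]. If [y] and [v] are neighbours on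
    [P], then [y] is outside [F] and a rotation at [v] makes it a head; otherwise their edge is new
    and [v] is already near a head. *)
Lemma posa_nbr i x v : x \in heads i -> e x v -> v \in P ->
  v \notin path_nbrs P F -> v \in near_heads i.+1.
Proof.
move=> /headsP[q r] exv; rewrite -(reach_mem r) in_cons => /orP[/eqP vx|].
  by rewrite vx e_irr in exv.
move=> vq; case/splitPr: vq r => p {}q r vN.
have H := reach_new_edge r (adjc_pivot x p v q).
case: (boolP (last x p \in F)) => yF; last exact: pivot_near r exv yF H.
case/orP: H => [h|]; last by apply: (subsetP (near_heads_step i)).
by case/negP: vN; rewrite inE; apply/exists_inP; exists (last x p).
Qed.

End Reach.
End Rotations.

(** * Hamiltonicity from edge distribution *)

(** Doubling at every step gives [2 ^ t <= s t]. The first step that fails to double yields the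
    bound, which persists by monotonicity. *)
Lemma doubling (c n t : nat) (s : nat -> nat) : 0 < c -> 0 < s 0 ->
    (forall i, s i <= s i.+1) ->
    (forall i, n <= c * s i.+1 \/ 2 * s i <= s i.+1) ->
  n <= 2 ^ t -> n <= c * s t.
Proof.
move=> c0 s0 smono H.
have : n <= c * s t \/ 2 ^ t <= s t.
  elim: t => [|t [IH|IH]]; first by right.
    by left; apply: leq_trans IH _; rewrite leq_mul2l smono orbT.
  by case: (H t) => h; [left|right; rewrite expnS; lia].
case=> // h nt; apply: leq_trans nt _; apply: leq_trans h _.
by rewrite leq_pmull.
Qed.

(** * Cutting a path into blocks *)

Section Blocks.
Variable T : eqType.
Implicit Types (f h : pred T) (b r : seq T) (bl : seq (seq T)).

Lemma count_block f b : count f b <= size b * all f b + size b * chg f b.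
Proof.
have cs := count_size f b; case: (boolP (all f b)) => af; first by nia.
case: (posnP (chg f b)) => [c0|]; last by nia.
case: b af c0 {cs} => [|x b] // af /chg_eq0/allP E.
have {}E y : y \in x :: b -> f y = f x.
  by rewrite in_cons => /orP[/eqP->|/E/eqP->].
case fx: (f x) E => E; first by case/negP: af; apply/allP => y /E.
by rewrite (@eq_in_count _ f pred0) ?count_pred0.
Qed.

(** A block that meets [f] without satisfying it throughout contains a change of its own, and
    contributes at most [m] vertices. *)
Lemma count_full_blocks f bl r m : (forall b, b \in bl -> size b = m) ->
  count f (flatten bl ++ r) <=
    m * count (all f) bl + m * chg f (flatten bl ++ r) + size r.
Proof.
elim: bl => [|b bl IH] sz; first by rewrite muln0 add0n /=; have := count_size f r; lia.
have {IH} /IH IH : forall b', b' \in bl -> size b' = m.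
  by move=> b' bl'; apply: sz; rewrite in_cons bl' orbT.
have := chg_cat_ge f b (flatten bl ++ r); have := count_block f b.
rewrite (sz b) ?mem_head // /= -catA count_cat; nia.
Qed.

Lemma count_good_blocks (g : pred (seq T)) f h bl r c k : (forall b, g b -> all f b) ->
    (forall b, b \in bl -> g b -> c <= k * count h b) ->
  c * count g bl <= k * count (predI h f) (flatten bl ++ r).
Proof.
move=> gf; elim: bl => [|b bl IH] H; first by rewrite muln0.
have {IH} /IH IH : forall b', b' \in bl -> g b' -> c <= k * count h b'.
  by move=> b' bl'; apply: H; rewrite in_cons bl' orbT.
rewrite /= -catA count_cat !mulnDr leq_add //.
case: (boolP (g b)) => gb; last by rewrite muln0.
rewrite muln1; apply: leq_trans (H b (mem_head _ _) gb) _.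
by rewrite (@eq_in_count _ (predI h f) h) // => x xb; rewrite /= (allP (gf b gb)) ?andbT.
Qed.

Lemma uniq_block bl b : uniq (flatten bl) -> b \in bl -> uniq b.
Proof.
elim: bl => // c bl IH; rewrite /= cat_uniq in_cons => /and3P[uc _ ubl].
by case/orP => [/eqP->//|]; exact: IH.
Qed.

Lemma blocks_of (P : seq T) (r m : nat) : r * m <= size P -> exists bl rest,
  [/\ P = flatten bl ++ rest, size bl = r,
      forall b, b \in bl -> size b = m & size rest = size P - r * m].
Proof.
move=> rm; exists (reshape (nseq r m) (take (r * m) P)), (drop (r * m) P).
have sh : sumn (nseq r m) = size (take (r * m) P).
  by rewrite sumn_nseq size_takel // mulnC.
split; last by rewrite size_drop.
- by rewrite reshapeKr ?cat_take_drop // sh.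
- by rewrite size_reshape size_nseq.
- move=> b bl; have : size b \in shape (reshape (nseq r m) (take (r * m) P)).
    by apply: map_f.
  by rewrite reshapeKl ?sh // => /nseqP[].
Qed.

End Blocks.

(** * Rotations of a longest path *)

Section Core.
Variables (T : finType) (e : rel T).
Hypotheses (e_sym : symmetric e) (e_irr : irreflexive e).
Implicit Types (x y u v w : T) (P Q : seq T) (F S Z W B : {set T}).

Definition nbrs v := [set w | e v w].

(* With degrees within a factor 2 of each other, an average vertex has at least
   a proportion [#|W| / (2 * #|T|)] of its neighbours in [W]. *)
Definition few_nbrs_bound K := forall S W,
  {in S, forall v, 4 * #|T| * #|nbrs v :&: W| <= #|W| * #|nbrs v|} ->
  K * #|S| * #|W| <= #|T| ^ 2.

(** The expansion property behind the growth arguments: if [W] is small, then the vertices sending a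
    proportion [1 / g] of their edges into it are fewer still. [K] will be of order [th ^- 2]. *)
Definition many_nbrs_bound K := forall g S W,
  {in S, forall v, #|nbrs v| <= g * #|nbrs v :&: W|} ->
  #|T| <= 4 * g * #|W| \/ K * #|S| <= g ^ 2 * #|W|.

Variable K : nat.
Hypotheses (few : few_nbrs_bound K) (many : many_nbrs_bound K).

Lemma card_nbrs_seq v b : uniq b -> #|nbrs v :&: [set x in b]| = count (e v) b.
Proof.
move=> ub; rewrite -size_filter -(card_uniqP (filter_uniq (e v) ub)).
by apply: eq_card => x; rewrite !inE mem_filter.
Qed.

(** By [posa_nbr], the usable neighbours [W] of the current heads number at most three times the
    next heads. Then [many] gives either the final bound, with [12 = 4 * 3], or doubling, since
    [6 * g ^ 2 <= K]. *)
Lemma heads_growth F P Z g t : uniq P -> path_nbrs P F \subset Z ->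
    0 < g -> 6 * g ^ 2 <= K -> #|T| <= 2 ^ t -> 0 < #|heads e F P 0| ->
    (forall i v, v \in heads e F P i ->
       #|nbrs v| <= g * #|nbrs v :&: ([set x in P] :\: Z)|) ->
  #|T| <= 12 * g * #|heads e F P t|.
Proof.
move=> uP FZ g0 gK nt h0 H.
apply: (doubling (s := fun i => #|heads e F P i|)) nt => //; first by lia.
  by move=> i; apply: subset_leq_card; exact: heads_step.
move=> i; pose W := (\bigcup_(v in heads e F P i) nbrs v) :&: ([set x in P] :\: Z).
have W3 : #|W| <= 3 * #|heads e F P i.+1|.
  apply: leq_trans (card_near_heads e F i.+1 uP).
  apply: subset_leq_card; apply/subsetP => w /setIP[/bigcupP[v vi]].
  rewrite inE => vw /setDP[]; rewrite inE => wP wZ.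
  apply: (posa_nbr e_irr vi) => //.
  by apply: contra wZ; exact: (subsetP FZ).
case: (many (g := g) (S := heads e F P i) (W := W)) => [v vi|h|h].
- apply: leq_trans (H i v vi) _; rewrite leq_mul2l; apply/orP; right.
  apply: subset_leq_card; apply/subsetP => w /setIP[vw wPZ].
  by rewrite !in_setI vw wPZ; apply/andP; split=> //; rewrite andbT; apply/bigcupP; exists v.
- by left; nia.
- right; have : 6 * g ^ 2 * #|heads e F P i| <= 3 * g ^ 2 * #|heads e F P i.+1|.
    apply: leq_trans (leq_mul gK (leqnn _)) _; apply: leq_trans h _.
    by rewrite (mulnC 3) -mulnA leq_mul2l W3 orbT.
  have : 0 < g ^ 2 by rewrite expn_gt0 g0.
  nia.
Qed.

Definition longest_path P := [/\ sorted e P, uniq P &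
  forall Q, sorted e Q -> uniq Q -> size Q <= size P].

(** Otherwise putting [v] in front of the rotated path would lengthen it. *)
Lemma longest_nbr P i x q v : longest_path P -> reach e set0 P i (x :: q) ->
  e x v -> v \in P.
Proof.
move=> [sP uP mP] r exv; apply: contraT => vP.
have := mP (v :: x :: q); rewrite -(perm_size (reach_perm r)) /= ltnn => -> //.
  by rewrite e_sym exv; exact: (reach_sorted e_sym sP r).
have := reach_uniq r uP => /= ->; rewrite andbT.
by have := reach_mem r v; rewrite (negbTE vP) => ->.
Qed.

Lemma longest_reach P i Q : longest_path P -> reach e set0 P i Q -> longest_path Q.
Proof.
move=> [sP uP mP] r; split; first exact: (reach_sorted e_sym sP r).
  exact: reach_uniq r uP.
by rewrite (perm_size (reach_perm r)).
Qed.

Lemma longest_rev P : longest_path P -> longest_path (rev P).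
Proof.
by case=> sP uP mP; split; rewrite ?rev_sortedC ?rev_uniq ?size_rev.
Qed.

Lemma head_heads F x p : x \in heads e F (x :: p) 0.
Proof. by apply/headsP; exists p; exact: Reach0. Qed.

(** Here [g = 1] works, because all neighbours of a head lie on the path. *)
Lemma longest_heads x p t : longest_path (x :: p) -> 6 <= K -> #|T| <= 2 ^ t ->
  #|T| <= 12 * #|heads e set0 (x :: p) t|.
Proof.
move=> lP K6 nt; have [_ uP _] := lP.
rewrite -[12]muln1; apply: (heads_growth (Z := set0)) => //.
- apply/subsetP => u; rewrite inE => /exists_inP[w]; by rewrite inE.
- by apply/card_gt0P; exists x; exact: head_heads.
move=> i v /headsP[q r]; rewrite mul1n; apply: subset_leq_card.
apply/subsetP => w vw; rewrite !inE in vw *; rewrite vw /=.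
by have := longest_nbr lP r vw; rewrite inE.
Qed.

Lemma rotate_out P B t : longest_path P -> P <> [::] -> 6 <= K ->
    #|T| <= 2 ^ t -> 12 * #|B| < #|T| ->
  exists x q, reach e set0 P t (x :: q) /\ x \notin B.
Proof.
case: P => // x p lP _ K6 nt cB; have := longest_heads lP K6 nt => h.
have : ~~ (heads e set0 (x :: p) t \subset B).
  apply/negP => /subset_leq_card; lia.
case/subsetPn => y /headsP[q r] yB; by exists y, q.
Qed.

(* Vertices with many neighbours next to the current set are added one by one;
   [many] stops this before the set doubles. *)
Lemma bad_closure P B g : uniq P -> 0 < g -> 8 * g * (2 * #|B|).+1 < #|T| ->
    4 * g ^ 2 <= K ->
  exists F, [/\ B \subset F, #|F| <= 2 * #|B| &
    forall v, v \notin F -> g * #|nbrs v :&: path_nbrs P F| < #|nbrs v|].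
Proof.
move=> uP g0 gB gK.
pose good F := (B \subset F) &&
  [forall u in F :\: B, #|nbrs u| <= g * #|nbrs u :&: path_nbrs P F|].
(* The extra unit leaves room for one more vertex: a maximal [F] turns out to have at most
   [2 * #|B|] elements, so adding a violating vertex contradicts maximality. *)
pose cap F := good F && (#|F| <= (2 * #|B|).+1).
have capB : cap B.
  rewrite /cap /good subxx /=; apply/andP; split; last by lia.
  by apply/forall_inP => u; rewrite setDv inE.
case: (@arg_maxnP _ B cap (fun F => #|F|) capB) => F /andP[/andP[BF /forall_inP gF] cF] mF.
have cF2 : #|F| <= 2 * #|B|.
  have cN := card_path_nbrs F uP; have cD := cardsD F B.
  have cBF := subset_leq_card BF.
  rewrite (setIidPr BF) in cD.
  case: (many (g := g) (S := F :\: B) (W := path_nbrs P F)) => [//|h|h]; first by nia.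
  have : 4 * g ^ 2 * #|F :\: B| <= 2 * g ^ 2 * #|F|.
    apply: leq_trans (leq_mul gK (leqnn _)) _; apply: leq_trans h _.
    by rewrite (mulnC 2) -mulnA leq_mul2l cN orbT.
  have : 0 < g ^ 2 by rewrite expn_gt0 g0.
  move: (g ^ 2) => G; rewrite cD; nia.
exists F; split=> // v vF; rewrite ltnNge; apply/negP => h.
have : cap (v |: F).
  rewrite /cap /good cardsU1 vF; apply/andP; split; last by lia.
  rewrite subsetU ?BF ?orbT //=; apply/forall_inP => u.
  have S : g * #|nbrs u :&: path_nbrs P F| <= g * #|nbrs u :&: path_nbrs P (v |: F)|.
    rewrite leq_mul2l subset_leq_card ?orbT //.
    by apply: setIS; apply: path_nbrsS; exact: subsetUr.
  rewrite in_setD in_setU1 => /andP[uB /orP[/eqP uv|uF]]; apply: leq_trans S.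
    by rewrite uv.
  by apply: gF; rewrite in_setD uB.
by move/mF; rewrite cardsU1 vF; lia.
Qed.

Definition bad_block m v b := 4 * #|T| * count (e v) b <= m * #|nbrs v|.

(* Since [f] changes at most [2 * t + 1] times along [P], at least [6 * t] of the
   [20 * t] blocks satisfy [f] throughout. *)
Lemma half_degree t m bl r f v (P := flatten bl ++ r) : 1 < t -> 0 < m ->
    size bl = 20 * t -> (forall b, b \in bl -> size b = m) ->
    size P = 20 * t * m + size r -> size r <= m ->
    chg f P <= (2 * t).+1 -> size P <= (2 * count f P).+1 ->
    #|T| <= 480 * t * m -> count (bad_block m v) bl < 2 * t ->
  #|nbrs v| <= 480 * count (predI (e v) f) P.
Proof.
move=> t1 m0 sbl szb sP sr chP cf nt badv.
have := count_full_blocks f r szb; rewrite -/P => full.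
have q6 : 6 * t <= count (all f) bl by nia.
pose g b := all f b && ~~ bad_block m v b.
have gq : count (all f) bl <= count g bl + count (bad_block m v) bl.
  rewrite -count_predUI; apply: leq_trans (leq_addr _ _); apply: sub_count => b /= fb.
  by rewrite /g fb /= orNb.
have : m * #|nbrs v| * count g bl <= 4 * #|T| * count (predI (e v) f) P.
  apply: count_good_blocks => [b /andP[]//|b _ /andP[_]].
  by rewrite /bad_block -ltnNge => /ltnW.
move: (count (predI _ _) P) => c h.
(* Of the [6 * t] full blocks fewer than [2 * t] are bad. Each of the others holds a share
   [m / (4 * #|T|)] of the neighbours, and [#|T| <= 480 * t * m]. *)
have {}h : m * #|nbrs v| * (4 * t) <= 4 * (480 * t * m) * c.
  apply: (@leq_trans (m * #|nbrs v| * count g bl)).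
    by rewrite leq_mul2l; apply/orP; right; lia.
  by apply: leq_trans h _; rewrite leq_mul2r leq_mul2l nt !orbT.
rewrite -(@leq_pmul2l (4 * t * m)); last by rewrite !muln_gt0 m0; lia.
by rewrite (_ : 4 * t * m * #|nbrs v| = m * #|nbrs v| * (4 * t)); [apply: leq_trans h _; lia|lia].
Qed.

(** Double counting of pairs of a vertex and a block bad for it: each counted vertex lies in at
    least [2 * t] pairs, while [few] bounds the pairs of each of the [20 * t] blocks. *)
Lemma card_bad t m bl : uniq (flatten bl) -> 0 < t -> size bl = 20 * t ->
    (forall b, b \in bl -> size b = m) ->
  K * #|[set v | 2 * t <= count (bad_block m v) bl]| * m <= 10 * #|T| ^ 2.
Proof.
move=> ub t0 sbl szb; set B := [set v | _].
have H1 : #|B| * (2 * t) <= \sum_(b <- bl) #|[set v | bad_block m v b]|.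
  rewrite -sum_nat_const; apply: (@leq_trans (\sum_v count (bad_block m v) bl)).
    rewrite [leqRHS](bigID (mem B)) /=; apply: leq_trans (leq_addr _ _).
    by apply: leq_sum => v; rewrite inE.
  rewrite (eq_bigr (fun v => \sum_(b <- bl) (bad_block m v b : nat))); last first.
    by move=> v _; rewrite -sum1_count big_mkcond; apply: eq_bigr => b _; case: ifP.
  rewrite exchange_big; apply: leq_sum => b _.
  rewrite -sum1_card [leqRHS]big_mkcond; apply: leq_sum => v _.
  by rewrite inE; case: (bad_block m v b).
have H2 : K * m * (\sum_(b <- bl) #|[set v | bad_block m v b]|) <= 20 * t * #|T| ^ 2.
  rewrite -sbl -sum1_size big_distrl big_distrr /= !big_seq; apply: leq_sum => b bbl.
  have uqb := uniq_block ub bbl.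
  have := few (S := [set v | bad_block m v b]) (W := [set x in b]).
  have -> : #|[set x in b]| = m by rewrite cardsE (card_uniqP uqb) szb.
  rewrite mul1n mulnAC; apply=> v; rewrite inE => h; by rewrite card_nbrs_seq.
rewrite -(@leq_pmul2l (2 * t)); last by lia.
have : K * m * (#|B| * (2 * t)) <= 20 * t * #|T| ^ 2.
  by apply: leq_trans H2; rewrite leq_mul2l H1 orbT.
move: (#|T| ^ 2) => n2; nia.
Qed.

(** Heads stay outside [F], so each has a proportion [1 / 480] of its neighbours on this half.
    Discarding those next to [F] on [P] and those in [Z] costs at most [1 / 1920] each, which leaves
    [1 / 960]. *)
Lemma half_heads P F Z x p t : uniq (x :: p) -> x \notin F ->
    (forall u w, adjc (x :: p) u w -> adjc P u w || (u \in Z)) ->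
    (forall v, v \notin F -> #|nbrs v| <= 480 * count (e v) (x :: p)) ->
    (forall v, v \notin F -> 1920 * #|nbrs v :&: path_nbrs P F| < #|nbrs v|) ->
    (forall v, 1920 * #|Z| <= #|nbrs v|) ->
    6 * 960 ^ 2 <= K -> #|T| <= 2 ^ t ->
  #|T| <= 12 * 960 * #|heads e F (x :: p) t|.
Proof.
move=> uP xF adjZ deg dF dZ gK nt.
apply: (heads_growth (Z := path_nbrs P F :|: Z)) => //.
- apply/subsetP => u; rewrite in_setU !inE => /exists_inP[w wF /adjZ/orP[h|->]].
    by apply/orP; left; apply/exists_inP; exists w.
  by rewrite orbT.
- by apply/card_gt0P; exists x; exact: head_heads.
move=> i v /headsP[q r]; have vF : v \notin F := @reach_head _ e F (x :: p) v i (v :: q) xF r.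
have := deg v vF; rewrite -(card_nbrs_seq v uP).
have := dF v vF; have := dZ v.
set a := #|nbrs v :&: (_ :\: _)|; set b := #|_ :&: path_nbrs P F|.
have : #|nbrs v :&: [set x0 in x :: p]| <= a + (b + #|Z|).
  rewrite /a setIDA.
  have E := cardsID (path_nbrs P F :|: Z) (nbrs v :&: [set x0 in x :: p]).
  have h1 : #|nbrs v :&: [set x0 in x :: p] :&: (path_nbrs P F :|: Z)| <=
      #|nbrs v :&: (path_nbrs P F :|: Z)|.
    by apply: subset_leq_card; apply: setSI; exact: subsetIl.
  have h2 : #|nbrs v :&: (path_nbrs P F :|: Z)| <= b + #|Z|.
    rewrite setIUr; apply: leq_trans (leq_card_setU _ _) _.
    by rewrite leq_add2l; apply: subset_leq_card; exact: subsetIr.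
  lia.
lia.
Qed.

(** Rotations of [Q1] and of [rev Q2] fix their last vertices, which are the ends of the edge
    joining the two halves. The rotated halves thus still form a path, and [e x y] closes it. *)
Lemma close_cycle F Q1 Q2 i j x p y q : sorted e (Q1 ++ Q2) ->
    uniq (Q1 ++ Q2) -> Q1 <> [::] -> Q2 <> [::] ->
    reach e F Q1 i (x :: p) -> reach e F (rev Q2) j (y :: q) -> e x y ->
  exists2 s, ucycle e s & perm_eq s (Q1 ++ Q2).
Proof.
move=> sQ uQ; case/lastP: Q1 sQ uQ => // Q1 a; case: Q2 => // b Q2 sQ uQ _ _ r1 r2 exy.
have pe : perm_eq ((x :: p) ++ rev (y :: q)) (rcons Q1 a ++ b :: Q2).
  apply: perm_cat; first exact: reach_perm r1.
  apply: (@perm_trans _ (y :: q)); first by rewrite perm_rev.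
  by apply: perm_trans (reach_perm r2) _; rewrite perm_rev.
exists ((x :: p) ++ rev (y :: q)) => //; rewrite /ucycle (perm_uniq pe) uQ andbT.
move: sQ; rewrite sorted_cat_cons => /andP[s1 s2].
have [la lb] : last x p = a /\ last y q = b.
  have := reach_last a r1; have := reach_last b r2.
  by rewrite rev_cons !last_rcons.
have eab : e a b.
  by case: Q1 s1 {uQ r1 pe} => [|c Q1] /=; rewrite ?andbT // !rcons_path last_rcons => /andP[].
have sp : sorted e (x :: p).
  apply: reach_sorted r1 => //.
  by case: Q1 s1 {uQ pe} => [|c Q1] //=; rewrite !rcons_path => /andP[].
have sq : sorted e (y :: q) by apply: reach_sorted r2; rewrite ?rev_sortedC.
rewrite cat_cons /cycle rcons_cat -rev_cons cat_path la; apply/andP; split=> //.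
change (sorted e (a :: rev (x :: y :: q))).
by rewrite -rev_rcons rev_sortedC //= rcons_path lb exy (e_sym b) eab andbT.
Qed.

Lemma longest_path_exists : exists P, longest_path P.
Proof.
pose ok k := `[< exists P, [/\ sorted e P, uniq P & size P = k] >].
have ex_ok : exists k, ok k by exists 0; apply/asboolP; exists [::].
have ub k : ok k -> k <= #|T|.
  by move=> /asboolP[P [_ uP <-]]; rewrite -(card_uniqP uP) max_card.
case: (ex_maxnP ex_ok ub) => k /asboolP[P [sP uP szP]] kmax.
exists P; split=> // Q sQ uQ; rewrite szP; apply: kmax.
by apply/asboolP; exists Q.
Qed.

(** [many] for the single vertex [v] and its own neighbourhood. It makes the vertices touched by a
    few rotations negligible against every degree. *)
Lemma card_nbrs_ge v : #|T| <= 4 * #|nbrs v| \/ K <= #|nbrs v|.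
Proof.
have := many (g := 1) (S := [set v]) (W := nbrs v).
rewrite cards1 !muln1 exp1n mul1n; apply=> u.
by rewrite inE => /eqP->; rewrite mul1n setIid.
Qed.

(** An edge leaving the cycle would open it into a longer path. So the missed set [S] is closed
    under neighbours, and [many] makes it at least a quarter of the graph; [few] then forces an edge
    between [S] and the cycle, as [48 = 4 * 12]. *)
Lemma longest_cycle_spans P s : longest_path P -> perm_eq s P -> ucycle e s ->
  #|T| <= 12 * size P -> 48 < K -> forall v, v \in s.
Proof.
move=> [sP uP mP] sPe /andP[cs us] nP K48 v0.
apply: contraT => v0s; pose S := [set v | v \notin s].
have noedge v u : v \in S -> e v u -> u \in S.
  rewrite !inE => vs evu; apply/negP => us'.
  case: (rot_to us') => k s' E.
  have /negP[] : ~~ (size [:: v, u & s'] <= size P).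
    by rewrite -(perm_size sPe) -(size_rot k s) E /= ltnn.
  apply: mP; last by rewrite cons_uniq -E mem_rot vs rot_uniq.
  by rewrite /= evu; move: cs; rewrite -(rot_cycle k) E /= rcons_path => /andP[].
have S0 : 0 < #|S| by apply/card_gt0P; exists v0; rewrite inE.
have big : #|T| <= 4 * #|S|.
  case: (many (g := 1) (S := S) (W := S)) => [v vS|h|]; last 1 first.
  - by rewrite exp1n mul1n => h; nia.
  - rewrite mul1n; apply: subset_leq_card; apply/subsetP => u h.
    by apply/setIP; split=> //; move: h; rewrite inE; exact: noedge.
  - by rewrite muln1 in h.
have sz : #|[set x in s]| = size P by rewrite cardsE (card_uniqP us) (perm_size sPe).
have := few (S := S) (W := [set x in s]); rewrite sz.
have T0 : 0 < #|T| by apply/card_gt0P; exists v0.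
have h : {in S, forall v, 4 * #|T| * #|nbrs v :&: [set x in s]| <= size P * #|nbrs v|}.
  move=> v vS; rewrite (_ : _ :&: _ = set0) ?cards0 ?muln0 //.
  apply/setP => u; rewrite !inE; apply/negP => /andP[/(noedge _ _ vS)].
  by rewrite inE => /negbTE->.
move/(_ h); have : #|T| ^ 2 <= 48 * (#|S| * size P).
  by apply: leq_trans (leq_mul big nP) _; lia.
have : 0 < #|S| * size P by rewrite muln_gt0 S0; lia.
rewrite -mulnA; move: (#|S| * size P) => y; nia.
Qed.

(** The factor [4800 * t] offsets the loss in [card_bad], so that at most a fraction
    [1 / (256 * 256)] of the vertices is exceptional. *)
Theorem hamiltonian_of_bounds t : 1 < t -> #|T| <= 2 ^ t ->
    4800 * (256 * 256) * t * t <= #|T| -> 4800 * (256 * 256) * t <= K ->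
  exists s : seq T, [/\ 3 <= size s, ucycle e s & forall v, v \in s].
Proof.
move=> t1 nt tn tK; have [P lP] := longest_path_exists.
have [sP uP mP] := lP.
have nbig : 4800 * (256 * 256) * 4 <= #|T|.
  by apply: leq_trans tn; rewrite -[leqRHS]mulnA leq_mul2l (leq_mul t1 t1) orbT.
have Kbig : 4800 * (256 * 256) * 2 <= K.
  by apply: leq_trans tK; rewrite leq_mul2l t1 orbT.
have T0 : 0 < #|T| by lia.
have Pn0 : P <> [::].
  by case/card_gt0P: T0 => v _ P0; have := mP [:: v]; rewrite P0 => /(_ isT isT).
have K6 : 6 <= K by lia.
have nP : #|T| <= 12 * size P.
  case: (P) lP Pn0 => // x p lP' _; apply: leq_trans (longest_heads lP' K6 nt) _.
  rewrite leq_mul2l; apply: leq_trans (card_size (x :: p)).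
  apply: subset_leq_card; apply/subsetP => y /headsP[q r].
  by rewrite -(reach_mem r) mem_head.
pose r := 20 * t; pose m := size P %/ r.
have r0 : 0 < r by rewrite /r; lia.
have szP := divn_eq (size P) r; rewrite -/m in szP.
have modr : size P %% r < r by rewrite ltn_mod.
(* This makes the remainder left over by the blocks no longer than one block. *)
have rm : r <= m.
  by rewrite /m leq_divRL // /r; nia.
have m0 : 0 < m by apply: leq_trans rm.
have ntm : #|T| <= 480 * t * m.
  have : t <= t * m by rewrite leq_pmulr.
  by move: szP modr; rewrite /r; move: (size P %% _) => d szP modr; lia.
have [|bl [rest [PE sbl szb srest]]] := @blocks_of _ P r m.
  by rewrite szP mulnC leq_addr.
have ubl : uniq (flatten bl) by move: uP; rewrite PE cat_uniq => /andP[].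
pose B := [set v | 2 * t <= count (bad_block m v) bl].
have cB : 256 * 256 * #|B| <= #|T|.
  have hB := card_bad ubl (ltnW t1) sbl szb; rewrite -/B in hB.
  have : #|T| * (K * #|B|) <= #|T| * (4800 * t * #|T|).
    apply: (@leq_trans (480 * t * m * (K * #|B|))); first by rewrite leq_mul2r ntm orbT.
    rewrite (_ : 480 * t * m * (K * #|B|) = 480 * t * (K * #|B| * m)); last by lia.
    rewrite (_ : #|T| * (4800 * t * #|T|) = 480 * t * (10 * #|T| ^ 2)); last by lia.
    by rewrite leq_mul2l hB orbT.
  rewrite leq_pmul2l // => {}hB.
  rewrite -(@leq_pmul2l (4800 * t)); last by lia.
  apply: leq_trans hB; rewrite mulnA leq_mul2r; apply/orP; right.
  by rewrite mulnAC.
have [||F [BF cF dF]] := bad_closure (B := B) uP (isT : 0 < 1920); [lia|lia|].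
have cF12 : 12 * #|F| < #|T| by clear -cF cB nbig; lia.
have [x [q [r1 xF]]] := rotate_out lP Pn0 K6 nt cF12.
(* Reversal gives access to the other end: [Q] will start at [y] and end at [x], both outside
   [F]. *)
have lP1 := longest_rev (longest_reach lP r1).
have P1n0 : rev (x :: q) <> [::] by move/(congr1 size); rewrite size_rev.
have [y [q' [r2 yF]]] := rotate_out lP1 P1n0 K6 nt cF12.
set Q := y :: q' in r2.
have pQ : perm_eq Q P.
  apply: perm_trans (reach_perm r2) _; apply: perm_trans (reach_perm r1).
  by rewrite perm_rev.
have [sQ uQ _] := longest_reach lP1 r2.
have [Z1 cZ1 aZ1] := reach_touched r1.
have [Z2 cZ2 aZ2] := reach_touched r2.
pose Z := Z1 :|: Z2.
have adjQ u w : adjc Q u w -> adjc P u w || (u \in Z).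
  by move/aZ2/orP; rewrite adjc_rev in_setU => -[/aZ1/orP[]|] ->; rewrite ?orbT.
have dZ v : 1920 * #|Z| <= #|nbrs v|.
  have cZ : #|Z| <= 4 * t by apply: leq_trans (leq_card_setU _ _) _; clear -cZ1 cZ2; lia.
  have tt : t <= t * t by rewrite leq_pmulr // ltnW.
  by case: (card_nbrs_ge v) => h; clear -h cZ tt tK tn; lia.
pose h := (size P)./2; pose Q1 := take h Q; pose Q2 := drop h Q.
have QE : Q = Q1 ++ Q2 by rewrite cat_take_drop.
have szQ : size Q = size P := perm_size pQ.
have sP1 : 3 < size P by clear -nP nbig; lia.
have szQ1 : size Q1 = h by rewrite size_takel // szQ /h; clear; lia.
have szQ2 : size Q2 = size P - h by rewrite size_drop szQ.
have := uQ; rewrite {1}QE cat_uniq => /and3P[uQ1 dQ uQ2].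
have chgP f : chg f P <= chg f Q + 2 * t.
  apply: leq_trans (reach_chg f r1) _.
  have := reach_chg f r2; rewrite chg_rev; clear; lia.
(* [R] will be a half of [Q], with indicator [f]. One change along [Q] becomes at most [2 * t + 1]
   along [P], as [half_degree] requires. *)
have half R f : uniq R -> {subset R <= Q} -> (forall v, v \in Q -> f v = (v \in R)) ->
    size P <= (2 * size R).+1 -> chg f Q <= 1 ->
    forall v, v \notin F -> #|nbrs v| <= 480 * count (e v) R.
  move=> uR RQ fR szR cf v vF.
  have cnt a : count (predI a f) P = count a R.
    have /seq.permP pe : perm_eq R (filter f P).
      apply: uniq_perm; rewrite ?filter_uniq // => w; rewrite mem_filter -(perm_mem pQ).
      case: (boolP (w \in Q)) => [/fR->|wQ]; rewrite ?andbT // andbF.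
      by apply: contraNF wQ; exact: RQ.
    by rewrite pe count_filter.
  rewrite -cnt PE; apply: (half_degree (t := t) (m := m)) => //; rewrite -?PE //.
  - by rewrite srest -/r subnKC // szP mulnC leq_addr.
  - by rewrite srest {1}szP [m * r]mulnC addKn (ltnW (leq_trans modr rm)).
  - by have := chgP f; clear -cf; lia.
  - by rewrite -(@eq_count _ (predI predT f)) // cnt count_predT.
  - rewrite ltnNge; apply/negP => bv; case/negP: vF; apply: (subsetP BF).
    by rewrite inE.
have K960 : 6 * 960 ^ 2 <= K by clear -Kbig; lia.
have HA : #|T| <= 12 * 960 * #|heads e F Q1 t|.
  have h0 : 0 < h by rewrite /h; clear -sP1; lia.
  have Q1E : Q1 = y :: behead Q1.
    by move: QE szQ1; rewrite {1}/Q; case: (Q1) => [_ E|z s [->]] //; rewrite -E in h0.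
  rewrite Q1E; apply: (half_heads (P := P) (Z := Z)) => //; rewrite -?Q1E //.
    by move=> u w a; apply: adjQ; rewrite QE; apply: adjc_sub; rewrite a.
  apply: (half Q1 (mem Q1)) => //.
  - by move=> w wQ1; rewrite QE mem_cat wQ1.
  - by rewrite szQ1 /h; clear; lia.
  - by rewrite QE; apply: chg_split => // w wQ2; exact: (hasPn dQ).
have lastQ : last y Q = x by rewrite (reach_last y r2) rev_cons last_rcons.
have HB : #|T| <= 12 * 960 * #|heads e F (rev Q2) t|.
  have Q2E : rev Q2 = x :: behead (rev Q2).
    move: lastQ szQ2; rewrite QE last_cat; case/lastP: (Q2) => [|z w].
      by rewrite /= /h; move: sP1; clear; lia.
    by rewrite last_rcons rev_rcons => ->.
  rewrite Q2E; apply: (half_heads (P := P) (Z := Z)) => //; rewrite -?Q2E ?rev_uniq //.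
    move=> u w; rewrite adjc_rev => a; apply: adjQ; rewrite QE.
    by apply: adjc_sub; rewrite a orbT.
  move=> v; rewrite count_rev; apply: (half Q2 (mem Q2)) => //.
  - by move=> w wQ2; rewrite QE mem_cat wQ2 orbT.
  - by rewrite szQ2 /h; clear; lia.
  rewrite QE -chg_rev rev_cat; apply: chg_split => w; rewrite !mem_rev => // wQ1.
  by apply/negP => /(hasPn dQ); rewrite wQ1.
have [a [b [aA bB eab]]] : exists a b,
    [/\ a \in heads e F Q1 t, b \in heads e F (rev Q2) t & e a b].
  apply: contrapT => no.
  (* Without an edge between the two head sets, [few] bounds the product of their sizes by
     [#|T| ^ 2 / K], but it is at least [#|T| ^ 2 / (12 * 960) ^ 2]. *)
  have := few (S := heads e F Q1 t) (W := heads e F (rev Q2) t).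
  have noedge : {in heads e F Q1 t, forall v,
      4 * #|T| * #|nbrs v :&: heads e F (rev Q2) t| <= #|heads e F (rev Q2) t| * #|nbrs v|}.
    move=> v vA; rewrite (_ : _ :&: _ = set0) ?cards0 ?muln0 //.
    apply/setP => u; rewrite in_setI in_set0; apply/negP => /andP[evu uB].
    by case: no; exists v, u; rewrite inE in evu.
  move/(_ noedge) => h'; have {}HA := leq_mul HA HB; clear -h' HA Kbig T0.
  move: h' HA; rewrite -mulnA mulnACA.
  move: (#|heads e F Q1 t| * #|heads e F (rev Q2) t|) => ab.
  rewrite mulnn => h' HA; have n0 : 0 < #|T| ^ 2 by rewrite expn_gt0 T0.
  have ab0 : 0 < ab.
    by rewrite lt0n; apply: contraTneq HA => ->; rewrite muln0 -ltnNge.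
  have := leq_trans h' HA.
  rewrite leq_pmul2r // => {}h'; clear -h' Kbig; lia.
have [p rp] := headsP _ _ _ _ _ aA; have [p' rp'] := headsP _ _ _ _ _ bB.
have Q1n0 : Q1 <> [::] by move=> Q10; move: szQ1 sP1; rewrite Q10 /h /=; clear; lia.
have Q2n0 : Q2 <> [::] by move=> Q20; move: szQ2 sP1; rewrite Q20 /h /=; clear; lia.
have sQ' : sorted e (Q1 ++ Q2) by rewrite -QE.
have uQ' : uniq (Q1 ++ Q2) by rewrite -QE.
have [s us sQe] := close_cycle sQ' uQ' Q1n0 Q2n0 rp rp' eab.
have sPe : perm_eq s P by apply: perm_trans pQ; rewrite QE.
exists s; split=> //; first by rewrite (perm_size sPe) ltnW.
by apply: longest_cycle_spans sPe us nP _ => //; clear -Kbig; lia.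
Qed.
End Core.

Import Order.TTheory GRing.Theory Num.Theory.
Local Open Scope ring_scope.

(** * Spectral gap and edge distribution *)

Lemma char_poly_conj (F : fieldType) n (P A : 'M[F]_n) : P \in unitmx ->
  char_poly (invmx P *m A *m P) = char_poly A.
Proof.
move=> uP; rewrite /char_poly /char_poly_mx !map_mxM.
set Q' := map_mx polyC (invmx P); set Q := map_mx polyC P.
have QQ : Q' *m Q = 1%:M by rewrite -map_mxM mulVmx // map_mx1.
have -> : 'X%:M - Q' *m map_mx polyC A *m Q = Q' *m ('X%:M - map_mx polyC A) *m Q.
  by rewrite mulmxBr mulmxBl scalar_mxC -(mulmxA 'X%:M) QQ mulmx1.
by rewrite !det_mulmx mulrAC -det_mulmx QQ det1 mul1r.
Qed.

Section SymmetricSpectrum.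
Variable R : rcfType.
Local Open Scope sesquilinear_scope.
Local Notation toC := (real_complex R).

Definition sqnorm n (z : 'cV[R]_n) := \sum_k z k 0 ^+ 2.

Lemma conj_toC (x : R) : (toC x)^* = toC x.
Proof. exact: conjc_real. Qed.

Lemma trC_map n m (A : 'M[R]_(m, n)) : (map_mx toC A)^t* = map_mx toC A^T.
Proof. by apply/matrixP => i j; rewrite !mxE conj_toC. Qed.

Lemma sqnormE n (z : 'cV[R]_n) (P : 'M[R[i]]_n) : P \is unitarymx ->
  toC (sqnorm z) = \sum_k `|(P *m map_mx toC z) k 0| ^+ 2.
Proof.
move=> /unitarymxP/mulmx1C PP; set w := P *m _.
have -> : \sum_k `|w k 0| ^+ 2 = (w^t* *m w) 0 0.
  by rewrite mxE; apply: eq_bigr => k _; rewrite !mxE normCKC.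
rewrite /w trmx_mul map_mxM mulmxA -(mulmxA _ (P^t*) P) PP mulmx1 trC_map -map_mxM.
by rewrite !mxE; congr toC; apply: eq_bigr => k _; rewrite mxE expr2.
Qed.

(** In a unitary eigenbasis over the complex numbers, [1 - A] scales each coordinate by
    [1 - lambda]. The kernel is spanned by [u], so [z] has no coordinate there, and all others
    shrink by the factor [th]. *)
Lemma sym_spectral_bound n (A : 'M[R]_n) (s : n.-tuple R) (i0 : 'I_n) th
    (u z : 'cV[R]_n) : A^T = A ->
    char_poly A = \prod_(x <- s) ('X - x%:P) -> th < 1 ->
    (forall i, i != i0 -> `|1 - tnth s i| <= th) ->
    A *m u = 0 -> u != 0 -> u^T *m z = 0 ->
  sqnorm (z - A *m z) <= th ^+ 2 * sqnorm z.
Proof.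
move=> symA chA th1 hth Au u0 uz.
pose B := map_mx toC A.
have /orthomx_spectral_subproof[[P D] /= uP BE] : B \is normalmx.
  by apply/normalmxP; rewrite /B trC_map symA.
have vP := unitarymx_unit uP.
have PB : P *m B = diag_mx D *m P by rewrite BE -(mulmxA (invmx P)) mulKVmx.
(* Equal characteristic polynomials match the diagonal with [s] up to a permutation. *)
have [p pE] : exists p : 'S_n, forall i, D 0 i = toC (tnth s (p i)).
  have : \prod_(x <- codom_tuple (D 0)) ('X - x%:P) =
      \prod_(x <- map_tuple toC s) ('X - x%:P).
    rewrite /= /codom /image_mem big_map big_enum /=.
    transitivity (char_poly B).
      rewrite BE char_poly_conj // char_poly_trig ?diag_mx_is_trig //.
      by apply: eq_bigr => i _; rewrite mxE eqxx.
    by rewrite /B -map_char_poly chA map_prod_XsubC big_map.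
  move/prod_XsubC_eq => pe.
  have /tuple_permP[p /= pE] : perm_eq (codom_tuple (D 0)) (map_tuple toC s) by [].
  exists p => i.
  have := congr1 (fun t => nth 0 t i) pE.
  rewrite (nth_map i) ?size_enum_ord // nth_ord_enum => ->.
  by rewrite (nth_map i) ?size_enum_ord // nth_ord_enum tnth_map.
pose v := P *m map_mx toC u; pose w := P *m map_mx toC z.
have Dv : diag_mx D *m v = 0.
  by rewrite /v mulmxA -PB -mulmxA -map_mxM Au map_mx0 mulmx0.
have Dvi i : D 0 i * v i 0 = 0.
  by have /matrixP/(_ i 0) := Dv; rewrite mul_diag_mx !mxE.
have [j vj] : exists j, v j 0 != 0.
  apply/cV0Pn; apply: contra u0 => /eqP v0.
  have : map_mx toC u = 0 by rewrite -(mulKmx vP (map_mx toC u)) -/v v0 mulmx0.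
  by move/eqP; rewrite map_mx_eq0.
have Dj : D 0 j = 0 by have /eqP := Dvi j; rewrite mulf_eq0 (negbTE vj) orbF => /eqP.
have pj : p j = i0.
  apply/eqP; apply: contraLR th1 => /hth.
  have := Dj; rewrite pE => /(congr1 (@complex.Re R)) /= ->.
  by rewrite subr0 normr1 -leNgt.
have far i : i != j -> `|1 - tnth s (p i)| <= th.
  by move=> ij; apply: hth; apply: contra ij => /eqP; rewrite -pj => /perm_inj->.
have vi i : i != j -> v i 0 = 0.
  move=> ij; have /eqP := Dvi i; rewrite mulf_eq0 => /orP[|/eqP//].
  rewrite pE => /eqP/(congr1 (@complex.Re R)) /= s0.
  by have := far i ij; rewrite s0 subr0 normr1 leNgt th1.
have wj : w j 0 = 0.
  have : v^t* *m w = 0.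
    rewrite /v /w trmx_mul map_mxM mulmxA -(mulmxA _ (P^t*) P).
    have /unitarymxP/mulmx1C -> := uP.
    by rewrite mulmx1 trC_map -map_mxM uz map_mx0.
  clear -vj vi; clearbody v w.
  move/matrixP/(_ 0 0); rewrite !mxE (bigD1 j) //= big1 ?addr0.
    by rewrite !mxE => /eqP; rewrite mulf_eq0 conjC_eq0 (negbTE vj) => /eqP.
  by move=> i ij; rewrite !mxE vi // conjC0 mul0r.
rewrite -lecR rmorphM /= !(sqnormE _ uP) -/w.
have -> : P *m map_mx toC (z - A *m z) = w - diag_mx D *m w.
  by rewrite map_mxB map_mxM mulmxBr -/w mulmxA PB -mulmxA.
clearbody w; rewrite mulr_sumr; apply: ler_sum => i _; rewrite mul_diag_mx !mxE.
case: (eqVneq i j) => [->|ij]; first by rewrite wj mulr0 subr0 normr0 expr0n /= mulr0.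
rewrite -{1}[w i 0]mul1r -mulrBl normrM exprMn ler_wpM2r ?exprn_ge0 //.
rewrite pE -[1](rmorph1 toC) -rmorphB /= rmorphXn /=.
have -> : `|toC (1 - tnth s (p i))| = toC `|1 - tnth s (p i)|.
  by rewrite normc_def /= expr0n addr0 sqrtr_sqr.
by rewrite -!rmorphXn lecR ler_pXn2r ?nnegrE ?far // (le_trans _ (far i ij)).
Qed.

End SymmetricSpectrum.

(** * Discrepancy of the normalized Laplacian *)

Section NormalizedLaplacianDiscrepancy.
Variables (R : realType) (n : nat) (e : rel 'I_n).
Hypotheses (e_sym : symmetric e) (deg_gt0 : forall v, (0 < degree e v)%N).
Local Notation L := (normalized_laplacian_mx R e).
Local Notation d v := ((degree e v)%:R : R).
Local Notation rt v := (Num.sqrt (d v)).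

Let d_gt0 v : 0 < d v. Proof. by rewrite ltr0n. Qed.
Let rt_gt0 v : 0 < rt v. Proof. by rewrite sqrtr_gt0. Qed.
Let rt2 v : rt v ^+ 2 = d v. Proof. by rewrite sqr_sqrtr // ltW. Qed.

Lemma normalized_laplacianE a b :
  L a b = (rt a)^-1 * ((a == b)%:R * d a - (e a b)%:R) * (rt b)^-1.
Proof.
rewrite /normalized_laplacian_mx /degree_invsqrt_mx mul_mx_diag mul_diag_mx !mxE.
by rewrite mulr_natl.
Qed.

Lemma normalized_laplacian_sym : L^T = L.
Proof.
apply/matrixP => a b; rewrite mxE !normalized_laplacianE e_sym eq_sym.
by case: eqP => [->|_]; rewrite ?mul1r ?mul0r; ring.
Qed.

Lemma normalized_laplacian_col (f : 'I_n -> R) a :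
  (L *m \col_v (rt v * f v)) a 0 =
  (rt a)^-1 * (d a * f a - \sum_(b | e a b) f b).
Proof.
rewrite mxE.
have -> : d a * f a - \sum_(b | e a b) f b =
    \sum_b ((a == b)%:R * d a - (e a b)%:R) * f b.
  under [RHS]eq_bigr do rewrite mulrBl.
  rewrite sumrB [X in _ = X - _](bigD1 a) //= eqxx mul1r [X in _ + X - _]big1 ?addr0 => [|b /negbTE ba].
    congr (_ - _); rewrite big_mkcond; apply: eq_bigr => b _.
    by case: (e a b); rewrite ?mul1r ?mul0r.
  by rewrite eq_sym ba !mul0r.
rewrite mulr_sumr; apply: eq_bigr => b _; rewrite normalized_laplacianE mxE.
by field; rewrite ?lt0r_neq0 // ?rt_gt0.
Qed.

Lemma sum_nbrs a : \sum_(b | e a b) 1 = d a.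
Proof.
by rewrite sumr_const /degree; congr (_%:R); apply: eq_card => b; rewrite inE.
Qed.

Variables (lambda : n.-tuple R) (th : R).
Hypotheses (n_gt0 : (0 < n)%N) (th1 : th < 1) (spec : ordered_spectrum L lambda)
  (gap : forall i : 'I_n, val i <> 0%N -> `|1 - tnth lambda i| <= th).

Definition vol (W : {set 'I_n}) := \sum_(v in W) d v.

Definition density W := vol W / vol setT.

Let vol_gt0 : 0 < vol setT.
Proof.
rewrite /vol (bigD1 (Ordinal n_gt0)) ?in_setT //=.
by rewrite ltr_pwDl // sumr_ge0 // => v _; rewrite ltW.
Qed.

(** A vertexwise expander mixing bound. The centred indicator [f], rescaled to [z] by square roots
    of degrees, is orthogonal to the kernel vector [u], and the left side is the squared norm of
    [z - L *m z]. *)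
Lemma discrepancy W :
  \sum_v (#|nbrs e v :&: W|%:R - density W * d v) ^+ 2 / d v <= th ^+ 2 * vol W.
Proof.
pose f v := (v \in W)%:R - density W.
pose z : 'cV[R]_n := \col_v (rt v * f v).
pose u : 'cV[R]_n := \col_v (rt v * 1).
have Lu : L *m u = 0.
  apply/matrixP => a k; rewrite ord1 normalized_laplacian_col sum_nbrs mxE.
  by rewrite mulr1 subrr mulr0.
have u0 : u != 0.
  by apply/cV0Pn; exists (Ordinal n_gt0); rewrite mxE mulr1 gt_eqF.
have volW : \sum_v d v * (v \in W)%:R = vol W.
  rewrite /vol [RHS]big_mkcond; apply: eq_bigr => v _.
  by case: (v \in W); rewrite ?mulr1 ?mulr0.
have volT : \sum_v d v = vol setT by apply: eq_bigl => v; rewrite in_setT.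
have dens : density W * vol setT = vol W by rewrite /density divfK // gt_eqF.
have uz : u^T *m z = 0.
  apply/matrixP => a b; rewrite !ord1 !mxE.
  transitivity (\sum_v (d v * (v \in W)%:R - density W * d v)).
    by apply: eq_bigr => v _; rewrite !mxE /f; have := rt2 v; set r := Num.sqrt _ => <-; ring.
  by rewrite sumrB volW -mulr_sumr volT dens subrr.
have [_ chL] := spec.
have gap' i : i != Ordinal n_gt0 -> `|1 - tnth lambda i| <= th.
  by move=> /eqP i0; apply: gap => i0'; apply: i0; exact: val_inj.
have := sym_spectral_bound normalized_laplacian_sym chL th1 gap' Lu u0 uz.
have -> : sqnorm (z - L *m z) =
    \sum_v (#|nbrs e v :&: W|%:R - density W * d v) ^+ 2 / d v.
  apply: eq_bigr => v _; have mxB (x y : 'cV[R]_n) : (x - y) v 0 = x v 0 - y v 0 by rewrite !mxE.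
  rewrite mxB normalized_laplacian_col mxE.
  have -> : \sum_(b | e v b) f b = #|nbrs e v :&: W|%:R - density W * d v.
    rewrite sumrB -sum_nbrs mulr_sumr; congr (_ - _).
      rewrite -sum1_card natr_sum big_mkcond [RHS]big_mkcond; apply: eq_bigr => b _.
      by rewrite in_setI inE; case: (e v b); case: (b \in W).
    by apply: eq_bigr => b _; rewrite mulr1.
  have := rt2 v; have := rt_gt0 v; set r := Num.sqrt _ => r0 <-.
  by field; rewrite gt_eqF.
move=> /le_trans; apply; apply: ler_wpM2l; first exact: sqr_ge0.
have -> : sqnorm z = vol W - density W * vol W.
  transitivity (\sum_v (d v * (v \in W)%:R -
      2 * density W * (d v * (v \in W)%:R) + density W ^+ 2 * d v)).
    apply: eq_bigr => v _; rewrite mxE exprMn rt2 /f.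
    by case: (v \in W); rewrite ?mulr1n ?mulr0n; ring.
  rewrite big_split /= sumrB -!mulr_sumr volW volT.
  rewrite (_ : density W ^+ 2 * vol setT = density W * vol W); last first.
    by rewrite -[in RHS]dens; ring.
  by ring.
rewrite gerBl mulr_ge0 ?divr_ge0 ?sumr_ge0 // => v _; rewrite ltW //.
Qed.


(** Chebyshev's argument: keep only the terms of [discrepancy] with [v] in [S]. *)
Lemma far_from_average (S W : {set 'I_n}) x : 0 <= x ->
    {in S, forall v, x * d v <= `|#|nbrs e v :&: W|%:R - density W * d v|} ->
  x ^+ 2 * vol S <= th ^+ 2 * vol W.
Proof.
move=> x0 H; apply: le_trans (discrepancy W).
rewrite /vol mulr_sumr [leRHS](bigID (mem S)) /=.
apply: ler_wpDr.
  by apply: sumr_ge0 => v _; rewrite divr_ge0 ?sqr_ge0 // ltW.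
apply: ler_sum => v vS; rewrite ler_pdivlMr // -mulrA -expr2 -exprMn.
rewrite -[leRHS]real_normK ?num_real //.
by rewrite ler_pXn2r ?nnegrE ?H // mulr_ge0 // ltW.
Qed.

Variables (delta K : nat).
Hypotheses (delta_gt0 : (0 < delta)%N)
  (deg_bounds : forall v, (delta <= degree e v <= 2 * delta)%N)
  (hK : 16 * K%:R * th ^+ 2 <= 1).

Let vol_ge (W : {set 'I_n}) : delta%:R * #|W|%:R <= vol W.
Proof.
rewrite mulr_natr -sumr_const; apply: ler_sum => v _; rewrite ler_nat.
by case/andP: (deg_bounds v).
Qed.

Let vol_le (W : {set 'I_n}) : vol W <= 2 * delta%:R * #|W|%:R.
Proof.
rewrite mulr_natr -sumr_const; apply: ler_sum => v _; rewrite -natrM ler_nat.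
by case/andP: (deg_bounds v).
Qed.

(** Since [density W] is at least [#|W| / (2 * n)], every vertex of [S] falls short of its expected
    count by at least half of it. *)
Lemma few_nbrs_of_gap : few_nbrs_bound e K.
Proof.
move=> S W; rewrite card_ord => H.
have [->|W0] := posnP #|W|; first by rewrite muln0.
have nR : 0 < n%:R :> R by rewrite ltr0n.
have dR : 0 < delta%:R :> R by rewrite ltr0n.
have WR : 0 < #|W|%:R :> R by rewrite ltr0n.
have T := vol_le setT; rewrite cardsT card_ord in T.
have vW := vol_ge W; have vS := vol_ge S.
have vW0 : 0 < vol W by apply: lt_le_trans vW; rewrite mulr_gt0.
have den : #|W|%:R / (2 * n%:R) <= density W.
  rewrite ler_pdivrMr ?mulr_gt0 // /density mulrAC ler_pdivlMr //.
  have : #|W|%:R * vol setT <= #|W|%:R * (2 * delta%:R * n%:R) by rewrite ler_pM2l.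
  have : 2 * n%:R * (delta%:R * #|W|%:R) <= 2 * n%:R * vol W.
    by rewrite ler_pM2l // mulr_gt0.
  by move: (vol W) (vol setT) => a b; lra.
have d0 : 0 < density W by rewrite divr_gt0.
have far : (density W / 2) ^+ 2 * vol S <= th ^+ 2 * vol W.
  apply: far_from_average => [|v vS']; first by rewrite divr_ge0 ?ltW.
  have := H v vS'; rewrite -(ler_nat R) !natrM => h.
  have {}h : #|nbrs e v :&: W|%:R <= density W / 2 * d v.
    apply: (@le_trans _ _ (#|W|%:R / (2 * n%:R) / 2 * d v)).
      rewrite -(@ler_pM2l _ (4 * n%:R)) ?mulr_gt0 //.
      by apply: le_trans h _; rewrite le_eqVlt; apply/orP; left; apply/eqP; field; rewrite gt_eqF.
    by rewrite ler_pM2r // ler_pM2r // invr_gt0.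
  have := ler_norm (- (#|nbrs e v :&: W|%:R - density W * d v)); rewrite normrN.
  by move: h; move: (d v) (density W) => y D; lra.
have {}far : vol W * vol S <= 4 * th ^+ 2 * vol setT ^+ 2.
  rewrite -(@ler_pM2l _ (vol W / vol setT ^+ 2 / 4)); last first.
    by rewrite divr_gt0 // divr_gt0 // exprn_gt0.
  move: far; rewrite /density; apply: etrans; congr (_ <= _).
    by field; rewrite gt_eqF.
  by field; rewrite gt_eqF.
have {}far : delta%:R ^+ 2 * (#|W|%:R * #|S|%:R) <= delta%:R ^+ 2 * (16 * th ^+ 2 * n%:R ^+ 2).
  apply: (@le_trans _ _ (vol W * vol S)).
    by rewrite expr2 mulrACA ler_pM // mulr_ge0 // ltW.
  apply: le_trans far _.
  have h : vol setT ^+ 2 <= (2 * delta%:R * n%:R) ^+ 2.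
    by rewrite ler_pXn2r ?nnegrE ?mulr_ge0 // ltW.
  have := ler_wpM2l (_ : 0 <= 4 * th ^+ 2) h; rewrite mulr_ge0 ?sqr_ge0 // => /(_ isT).
  by move/le_trans; apply; rewrite le_eqVlt; apply/orP; left; apply/eqP; ring.
move: far; rewrite ler_pM2l ?exprn_gt0 // => far.
rewrite -(ler_nat R) natrX !natrM -mulrA [#|S|%:R * _]mulrC.
apply: le_trans (ler_wpM2l (ler0n R K) far) _.
rewrite (_ : K%:R * (16 * th ^+ 2 * n%:R ^+ 2) = 16 * K%:R * th ^+ 2 * n%:R ^+ 2); last by ring.
by rewrite ler_piMl ?sqr_ge0.
Qed.

(** If [4 * g * #|W| < n], then [density W] is at most [1 / (2 * g)], so every vertex of [S] exceeds
    its expected count by a proportion [1 / (2 * g)] of its degree. *)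
Lemma many_nbrs_of_gap : many_nbrs_bound e K.
Proof.
move=> g S W; rewrite card_ord => H.
have [->|/set0Pn[v0 v0S]] := eqVneq S set0; first by right; rewrite cards0 muln0.
have g0 : (0 < g)%N.
  by have := H v0 v0S; case: (g) => // /leq_trans/(_ (leqnn _)); rewrite mul0n leqNgt deg_gt0.
case: (leqP n (4 * g * #|W|)) => nW; [by left|right].
have nR : 0 < n%:R :> R by rewrite ltr0n.
have dR : 0 < delta%:R :> R by rewrite ltr0n.
have gR : 0 < g%:R :> R by rewrite ltr0n.
have T := vol_ge setT; rewrite cardsT card_ord in T.
have vW := vol_le W; have vS := vol_ge S.
have den : density W <= (2 * g%:R)^-1.
  rewrite ler_pdivrMr // ler_pdivlMl ?mulr_gt0 //.
  apply: le_trans T; apply: (@le_trans _ _ (2 * g%:R * (2 * delta%:R * #|W|%:R))).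
    by rewrite ler_pM2l // mulr_gt0.
  have : delta%:R * (4 * g%:R * #|W|%:R) <= delta%:R * n%:R :> R.
    by rewrite ler_pM2l // -!natrM ler_nat ltnW.
  apply: le_trans.
  by rewrite le_eqVlt; apply/orP; left; apply/eqP; ring.
have far : (2 * g%:R)^-1 ^+ 2 * vol S <= th ^+ 2 * vol W.
  apply: far_from_average => [|v vS']; first by rewrite invr_ge0 mulr_ge0.
  apply: le_trans (ler_norm _).
  have := H v vS'; rewrite -(ler_nat R) natrM => h.
  have {}h : d v / g%:R <= #|nbrs e v :&: W|%:R by rewrite ler_pdivrMr // mulrC.
  have : density W * d v <= (2 * g%:R)^-1 * d v by rewrite ler_pM2r.
  rewrite (_ : d v / g%:R = (2 * g%:R)^-1 * d v + (2 * g%:R)^-1 * d v) in h.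
    by move: h; move: (_^-1 * _) (density W * _) => y D; lra.
  by field; rewrite gt_eqF.
have {}far : delta%:R * #|S|%:R <= delta%:R * (8 * g%:R ^+ 2 * th ^+ 2 * #|W|%:R).
  apply: le_trans vS _.
  have : th ^+ 2 * vol W <= th ^+ 2 * (2 * delta%:R * #|W|%:R) by rewrite ler_wpM2l ?sqr_ge0.
  move/(le_trans far) => h.
  have : 4 * g%:R ^+ 2 * ((2 * g%:R)^-1 ^+ 2 * vol S) <=
      4 * g%:R ^+ 2 * (th ^+ 2 * (2 * delta%:R * #|W|%:R)).
    by rewrite ler_pM2l // mulr_gt0 ?exprn_gt0.
  rewrite (_ : 4 * g%:R ^+ 2 * (_ * vol S) = vol S); last by field; rewrite gt_eqF.
  move/le_trans; apply; rewrite le_eqVlt; apply/orP; left; apply/eqP; ring.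
move: far; rewrite ler_pM2l // => far.
rewrite -(ler_nat R) 2!natrM natrX; apply: le_trans (ler_wpM2l (ler0n R K) far) _.
rewrite (_ : K%:R * (8 * g%:R ^+ 2 * th ^+ 2 * #|W|%:R) =
  8 * K%:R * th ^+ 2 * (g%:R ^+ 2 * #|W|%:R)); last by ring.
rewrite ler_piMl ?mulr_ge0 ?sqr_ge0 //.
by apply: le_trans hK; rewrite ler_wpM2r ?sqr_ge0 // ler_wpM2r // ler_nat.
Qed.

End NormalizedLaplacianDiscrepancy.

(** * Asymptotics of the gap *)

Lemma ln2_ge (R : realType) : 2^-1 <= ln (2 : R).
Proof.
have := @le_ln1Dx R (- 2^-1); rewrite (_ : 1 + - 2^-1 = 2^-1); last by lra.
by rewrite lnV ?posrE // => /(_ _); lra.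
Qed.

(** With [y = ln n] and [s = ln y], the choice [t <= 4 * y] makes [t * th ^+ 2] of order at most
    [s ^+ 4 / y], which tends to [0]. *)
Lemma gap_asymptotics (R : realType) (C : nat) : (0 < C)%N ->
  exists n0 : nat, forall n, (n0 <= n)%N ->
  let th : R := ln (ln n%:R) ^+ 2 / (7500 * ln n%:R * ln (ln (ln n%:R))) in
  exists t : nat, [/\ (1 < t)%N, (n <= 2 ^ t)%N, (C * t * t <= n)%N,
    16 * (C * t)%:R * th ^+ 2 <= 1 & th < 1].
Proof.
move=> C0; have C1 : 1 <= C%:R :> R by rewrite ler1n.
(* [n >= N] gives [s >= M]: the term [expR 1] ensures [l >= 1], and [100 * C] ensures [s >= C] and
   [y >= 96 * C]. *)
pose M : R := 100 * C%:R + expR 1; pose N := expR (expR M).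
have e1 := expR_gt0 (1 : R).
exists (Num.truncn N).+1 => n nN th.
have {nN}nN : N <= n%:R.
  by apply/ltW/(lt_le_trans (truncnS_gt N)); rewrite ler_nat.
have n0 : 0 < n%:R :> R by apply: lt_le_trans nN; exact: expR_gt0.
pose y : R := ln n%:R; pose s := ln y; pose l := ln s.
have yM : expR M <= y by rewrite -[expR M]expRK ler_ln // posrE expR_gt0.
have y0 : 0 < y := lt_le_trans (expR_gt0 M) yM.
have sM : M <= s by rewrite -[M]expRK ler_ln // posrE expR_gt0.
have s0 : 0 < s by apply: lt_le_trans sM; rewrite /M; lra.
have l1 : 1 <= l.
  by rewrite -[1]expRK ler_ln ?posrE // (le_trans _ sM) // /M; move: C1; clear; lra.
have yE : expR y = n%:R by rewrite lnK ?posrE.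
have sE : expR s = y by rewrite lnK ?posrE.
have thE : th = s ^+ 2 / (7500 * y * l) by [].
clearbody th.
have sC : C%:R <= s by apply: le_trans sM; rewrite /M; move: C1 e1; clear; lra.
clearbody l.
have yC : 96 * C%:R <= y.
  apply: le_trans yM; apply: le_trans (expR_ge1Dx _); rewrite /M; move: C1 e1; clear; lra.
(* One Taylor term of [expR s]; with [C <= s] it absorbs [C * s ^+ 4] into [y]. *)
have ys : s ^+ 5 / 120 <= y.
  have := @expR_ge1Dxn R s 4 (ltW s0); rewrite sE; apply: le_trans.
  by rewrite lerDr.
clearbody s.
have ny : y ^+ 3 / 6 <= n%:R.
  have := @expR_ge1Dxn R y 2 (ltW y0); rewrite yE; apply: le_trans.
  by rewrite lerDr.
have n0' : (0 < n)%N by rewrite -(ltr_nat R).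
(* One unit makes [2 ^ t] exceed [n]; the other ensures [1 < t]. *)
clearbody y; pose t := (trunc_log 2 n).+2; exists t.
have ty : t%:R <= 4 * y.
  have : (trunc_log 2 n)%:R * ln 2 <= y.
    rewrite -[y]expRK yE mulr_natl -lnXn // ler_ln ?posrE ?exprn_gt0 //.
    by rewrite -natrX ler_nat trunc_logP.
  have : (trunc_log 2 n)%:R * 2^-1 <= (trunc_log 2 n)%:R * ln (2 : R).
    by rewrite ler_wpM2l // ln2_ge.
  have -> : t%:R = (trunc_log 2 n)%:R + 2 :> R by rewrite /t -addn2 natrD.
  move: yC C1; clear; lra.
have th0 : 0 <= th.
  by rewrite thE divr_ge0 ?sqr_ge0 // mulr_ge0 ?mulr_ge0 // ltW // (lt_le_trans _ l1).
have key : 16 * (C * t)%:R * th ^+ 2 <= 1.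
  have thle : th <= s ^+ 2 / (7500 * y).
    rewrite thE ler_pdivrMr; last by rewrite !mulr_gt0 // (lt_le_trans _ l1).
    rewrite (_ : _ / _ * _ = s ^+ 2 * l); last by field; rewrite gt_eqF.
    by rewrite ler_peMr // sqr_ge0.
  have th2 : th ^+ 2 <= (s ^+ 2 / (7500 * y)) ^+ 2.
    by rewrite ler_pXn2r ?nnegrE // (le_trans th0).
  have tt : 16 * (C * t)%:R <= 64 * C%:R * y.
    rewrite natrM; have : C%:R * t%:R <= C%:R * (4 * y) by rewrite ler_pM2l ?(lt_le_trans ltr01).
    by clear; lra.
  apply: (@le_trans _ _ (64 * C%:R * y * (s ^+ 2 / (7500 * y)) ^+ 2)).
    by apply: ler_pM => //; rewrite ?sqr_ge0 // mulr_ge0.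
  have -> : 64 * C%:R * y * (s ^+ 2 / (7500 * y)) ^+ 2 = 64 * C%:R * s ^+ 4 / (7500 ^+ 2 * y).
    by field; rewrite gt_eqF.
  rewrite ler_pdivrMr ?mul1r; last by rewrite mulr_gt0 ?exprn_gt0.
  have : C%:R * s ^+ 4 <= s ^+ 5 by rewrite [leRHS]exprS ler_pM2r ?exprn_gt0.
  have s4 : 0 <= C%:R * s ^+ 4 by rewrite mulr_ge0 ?exprn_ge0 // ltW.
  rewrite -(mulrA 64); move: s4 ys y0; move: (C%:R * s ^+ 4) (s ^+ 5) => a b; clear; lra.
split=> //.
- have := trunc_log_ltn n (isT : 1 < 2)%N; rewrite /t => /ltnW/leq_trans; apply.
  by rewrite leq_exp2l.
- rewrite -(ler_nat R) !natrM; apply: le_trans ny.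
  apply: (@le_trans _ _ (C%:R * (4 * y) * (4 * y))).
    by rewrite ler_pM ?mulr_ge0 // ler_pM2l // (lt_le_trans ltr01).
  rewrite (_ : _ * _ = (96 * C%:R) * y ^+ 2 / 6); last by field.
  by rewrite ler_pM2r ?invr_gt0 // [leRHS]exprS ler_pM2r ?exprn_gt0.
rewrite ltNge; apply/negP => th1.
have : 1 <= (C * t)%:R * th ^+ 2.
  by rewrite mulr_ege1 ?exprn_ege1 // ler1n muln_gt0 C0.
by move: key; rewrite -mulrA; lra.
Qed.

Lemma min_degree_le n (e : rel 'I_n) v : (min_degree e <= degree e v)%N.
Proof.
rewrite /min_degree; have := mem_index_enum v.
elim: (index_enum _) => // u r IH; rewrite big_cons in_cons geq_min.
by case/orP => [/eqP->|/IH->]; rewrite ?leqnn ?orbT.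
Qed.

Lemma min_degree_gt0 n (e : rel 'I_n) : (0 < n)%N ->
  (forall v, (0 < degree e v)%N) -> (0 < min_degree e)%N.
Proof.
by move=> n0 d0; apply: (big_ind (fun k => (0 < k)%N)) => // a b a0 b0; rewrite leq_min a0.
Qed.

Theorem theorem1p1 (R : realType) (c : R) (hc : c < Num.sqrt 2) :
  exists n0 : nat, forall (n : nat), (n0 <= n)%N ->
  forall e : rel 'I_n, simple_graph e -> no_isolated_vertex e ->
  (max_degree e)%:R / (min_degree e)%:R < c ->
  forall lambda : n.-tuple R,
  ordered_spectrum (normalized_laplacian_mx R e) lambda ->
  (forall i : 'I_n, val i <> 0%N ->
     `|1 - tnth lambda i| <=
       ln (ln n%:R) ^+ 2 / (7500 * ln n%:R * ln (ln (ln n%:R)))) ->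
  hamiltonian e.
Proof.
have [n0 H] := @gap_asymptotics R (4800 * (256 * 256))%N isT.
exists (n0 + 1)%N => n nn0 e [e_sym e_irr] iso ratio lambda spec gap.
have n_gt0 : (0 < n)%N by apply: leq_trans nn0; rewrite addn1.
have {H nn0}[t [t1 nt tn hK th1]] := H n (leq_trans (leq_addr 1 n0) nn0).
have d0 v : (0 < degree e v)%N.
  by have [w evw] := iso v; apply/card_gt0P; exists w; rewrite inE.
have m0 := min_degree_gt0 n_gt0 d0.
have bounds v : (min_degree e <= degree e v <= 2 * min_degree e)%N.
  rewrite min_degree_le; apply: (@leq_trans (max_degree e)); first exact: leq_bigmax.
  rewrite -(ler_nat R) natrM -ler_pdivrMr ?ltr0n //.
  apply/ltW/(lt_le_trans (lt_trans ratio hc)).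
  (* The degree ratio is below [sqrt 2 <= sqrt (2 ^ 2) = 2]. *)
  rewrite -[leRHS](@ger0_norm R 2) // -sqrtr_sqr ler_wsqrtr //.
  by rewrite -natrX ler_nat.
have := hamiltonian_of_bounds e_sym e_irr
  (few_nbrs_of_gap e_sym d0 n_gt0 th1 spec gap m0 bounds hK)
  (many_nbrs_of_gap e_sym d0 n_gt0 th1 spec gap m0 bounds hK) t1.
by rewrite card_ord; apply.
Qed.
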